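(* Let $\mathbb{X}$ be a countable $\omega$-categorical relational structure which is homogeneous and homomorphism-homogeneous and such that the age of $\mathbb{X}$ has the strong amalgamation property with homomorphism gluing. Then $\operatorname{End}(\mathbb{X})$ equipped with the pointwise topology has property $\mathbf{X}$ with respect to $\operatorname{Aut}(\mathbb{X})$.
   Context: Functions are written on the right of their arguments and composed from left to right. Relational structures have relations only. A partial map between structures is called a homomorphism if it is a homomorphism from the induced substructure on its domain. $\operatorname{End}(\mathbb{X})$ and $\operatorname{Aut}(\mathbb{X})$ are the endomorphism monoid and the automorphism group of $\mathbb{X}$; $X$ is the domain of $\mathbb{X}$. The age of $\mathbb{X}$ is the class of all finite structures which embed into $\mathbb{X}$. Homogeneous: every isomorphism between finite induced substructures of $\mathbb{X}$ extends to an automorphism of $\mathbb{X}$. Homomorphism-homogeneous: every homomorphism between finite induced substructures of $\mathbb{X}$ extends to an endomorphism of $\mathbb{X}$. $\omega$-categorical: the first-order theory has a unique countably infinite model up to isomorphism. Strong amalgamation property with homomorphism gluing: let $\sigma$ be a finite relational signature. A class $\mathcal{C}$ of finite $\sigma$-structures has this property if for any $\mathbb{A},\mathbb{B},\mathbb{C}\in\mathcal{C}$ and any embeddings $e_1\colon\mathbb{A}\to\mathbb{B}$, $e_2\colon\mathbb{A}\to\mathbb{C}$ there exist $\mathbb{D}\in\mathcal{C}$ and embeddings $f_1\colon\mathbb{B}\to\mathbb{D}$, $f_2\colon\mathbb{C}\to\mathbb{D}$ such that (i) $e_1f_1=e_2f_2$ and $\operatorname{im}(f_1)\cap\operatorname{im}(f_2)=(A)e_1f_1=(A)e_2f_2$;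 (ii) if $g\colon D\to E$ is a partial map for some $\mathbb{E}\in\mathcal{C}$ such that $(A)e_1f_1=(A)e_2f_2\subseteq\operatorname{dom}(g)$ and the (partial) maps $f_1g$ and $f_2g$ are homomorphisms, then $g$ is also a homomorphism. The pointwise topology on $\operatorname{End}(\mathbb{X})$ has subbasis the sets $\{f : (x)f=y\}$, $x,y\in X$. Property $\mathbf{X}$: if $S$ is a topological semigroup and $A\subseteq S$, then $S$ has property $\mathbf{X}$ with respect to $A$ if for every $s\in S$ there exist $f_s,g_s\in S$ and $t_s\in A$ such that $s=f_st_sg_s$ and for every neighbourhood $B$ of $t_s$ the set $f_s(B\cap A)g_s$ is a neighbourhood of $s$. *)

(* Defs.v *)
From HB Require Import structures.
From mathcomp Require Import all_boot finmap.
From mathcomp Require Import all_classical.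
From mathcomp Require Import topology_structure product_topology.

Set Implicit Arguments.
Unset Strict Implicit.
Unset Printing Implicit Defensive.

Local Open Scope classical_set_scope.
Local Open Scope group_scope.

(* Arity 0 is allowed. *)
Record signature := Signature {
  symbol :> finType;
  arity : symbol -> nat
}.

(* The carrier is an arbitrary type, possibly empty. *)
Record relStruct (s : signature) := RelStruct {
  carrier :> Type;
  interp : forall r : s, ('I_(arity r) -> carrier) -> Prop
}.

Section Morphisms.
Variable s : signature.
Implicit Types A B : relStruct s.

Definition is_hom A B (f : A -> B) :=
  forall (r : s) (t : 'I_(arity r) -> A), interp t -> interp (f \o t).

Definition is_embedding A B (f : A -> B) :=
  injective f /\
  forall (r : s) (t : 'I_(arity r) -> A), interp t <-> interp (f \o t).

Definition is_iso A B (f : A -> B) := is_embedding f /\ bijective f.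

Definition isomorphic A B := exists f : A -> B, is_iso f.

Definition induced A (P : set A) : relStruct s :=
  @RelStruct s (set_type P)
    (fun r t => interp (fun i => set_val (t i) : A)).

Definition finite_struct A := finite_set [set: A].

Definition age A : relStruct s -> Prop :=
  fun B => finite_struct B /\ exists e : B -> A, is_embedding e.

Record partial_map A B := PartialMap {
  pdom : set A;
  pfun : induced pdom -> B
}.

Definition is_partial_hom A B (g : partial_map A B) := is_hom (@pfun _ _ g).

(* The composite "first f, then g", with domain the preimage of that of g. *)
Definition pcomp A B C (f : A -> B) (g : partial_map B C) : partial_map A C :=
  @PartialMap A C (f @^-1` pdom g)
    (fun x => @pfun _ _ g (SigSub (mem_set (set_valP x : pdom g (f (set_val x)))))).

End Morphisms.

Arguments pdom {s A B}.
Arguments pfun {s A B}.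

Section Homogeneity.
Variables (s : signature) (X : relStruct s).

Definition homogeneous :=
  forall (P Q : set X) (f : induced P -> induced Q),
    finite_set P -> finite_set Q -> is_iso f ->
    exists2 a : X -> X, is_iso a &
      forall x : induced P, a (set_val x) = set_val (f x).

Definition hom_homogeneous :=
  forall (P Q : set X) (f : induced P -> induced Q),
    finite_set P -> finite_set Q -> is_hom f ->
    exists2 a : X -> X, is_hom a &
      forall x : induced P, a (set_val x) = set_val (f x).

End Homogeneity.

(* [formula s n] has its free variables in ['I_n]; [FAll] binds the last
   variable [ord_max] of its argument. *)
Inductive formula (s : signature) : nat -> Type :=
| FRel n (r : s) (v : 'I_(arity r) -> 'I_n) : formula s n
| FEq n (i j : 'I_n) : formula s n
| FBot n : formula s n
| FImp n (p q : formula s n) : formula s n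
| FAll n (p : formula s n.+1) : formula s n.

Section FirstOrder.
Variable s : signature.

Definition extend_val (X : Type) n (v : 'I_n -> X) (x : X) : 'I_n.+1 -> X :=
  fun i => oapp v x (unlift ord_max i).

Fixpoint sat (X : relStruct s) n (p : formula s n) : ('I_n -> X) -> Prop :=
  match p in formula _ n return ('I_n -> X) -> Prop with
  | FRel _ r t => fun v => interp (v \o t)
  | FEq _ i j => fun v => v i = v j
  | FBot _ => fun _ => False
  | FImp _ p q => fun v => sat p v -> sat q v
  | FAll _ p => fun v => forall x : X, sat p (extend_val v x)
  end.

Definition sentence := formula s 0.

Definition models (X : relStruct s) (p : sentence) :=
  forall v : 'I_0 -> X, sat p v.

Definition theory (X : relStruct s) : set sentence := [set p | models X p].

Definition countably_infinite_model (T : set sentence) (M : relStruct s) :=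
  ([set: M] #= [set: nat])%card /\ (forall p, T p -> models M p).

Definition omega_categorical (X : relStruct s) :=
  (exists M, countably_infinite_model (theory X) M) /\
  (forall M N, countably_infinite_model (theory X) M ->
     countably_infinite_model (theory X) N -> isomorphic M N).

End FirstOrder.

Definition strong_amalgamation_hom_gluing (s : signature)
    (C : relStruct s -> Prop) :=
  forall (A B1 B2 : relStruct s) (e1 : A -> B1) (e2 : A -> B2),
    C A -> C B1 -> C B2 -> is_embedding e1 -> is_embedding e2 ->
    exists (D : relStruct s) (f1 : B1 -> D) (f2 : B2 -> D),
      [/\ C D, is_embedding f1, is_embedding f2,
          (f1 \o e1 = f2 \o e2 /\
           range f1 `&` range f2 = range (f1 \o e1)) &
          forall (E : relStruct s) (g : partial_map D E),
            C E -> range (f1 \o e1) `<=` pdom g ->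
            is_partial_hom (pcomp f1 g) -> is_partial_hom (pcomp f2 g) ->
            is_partial_hom g].

HB.mixin Record isTopologicalSemigroup S & Topological S & Semigroup S := {
  mulg_continuous : continuous (fun p : S * S => p.1 * p.2)
}.

#[short(type="topologicalSemigroupType")]
HB.structure Definition TopologicalSemigroup :=
  {S of isTopologicalSemigroup S & Topological S & Semigroup S}.

Definition property_X (S : topologicalSemigroupType) (A : set S) :=
  forall x : S, exists f g t : S,
    [/\ A t, x = f * t * g &
        forall B : set S, nbhs t B ->
          nbhs x [set f * b * g | b in B `&` A]].

Record endo (s : signature) (X : relStruct s) := Endo {
  endo_fun :> X -> X;
  endo_hom : is_hom endo_fun
}.

Section Endomorphisms.
Variables (s : signature) (X : relStruct s).
Implicit Types f g h : endo X.

Lemma endoP f g : f =1 g -> f = g.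
Proof.
case: f g => [f fh] [g gh] /= /funext fg.
by case: _ / fg gh => gh; rewrite (Prop_irrelevance fh gh).
Qed.

Definition endo_one : endo X := @Endo s X id (fun r t rt => rt).

(* Maps act on the right: f * g is f followed by g. *)
Definition endo_mul f g : endo X :=
  @Endo s X (g \o f) (fun r t rt => endo_hom g (endo_hom f rt)).

Lemma endo_mulA : associative endo_mul. Proof. by move=> f g h; apply: endoP. Qed.
Lemma endo_1mul : left_id endo_one endo_mul. Proof. by move=> f; apply: endoP. Qed.
Lemma endo_mul1 : right_id endo_one endo_mul. Proof. by move=> f; apply: endoP. Qed.

HB.instance Definition _ := gen_eqMixin (endo X).
HB.instance Definition _ := gen_choiceMixin (endo X).
HB.instance Definition _ :=
  isMonoid.Build (endo X) endo_mulA endo_1mul endo_mul1.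

Definition pointwise_subbase : set (set (endo X)) :=
  [set U | exists x y : X, U = [set f : endo X | f x = y]].

HB.instance Definition _ :=
  isSubBaseTopological.Build (endo X) pointwise_subbase id.

Lemma nbhs_pointwise f (x : X) : nbhs f [set h : endo X | h x = f x].
Proof.
pose U := [set h : endo X | h x = f x].
apply: open_nbhs_nbhs; split=> //.
exists [set U]; last by rewrite bigcup_set1.
move=> _ ->; exists [fset U]%fset.
  by move=> V /fset1P ->; apply/mem_set; exists x, (f x).
by rewrite set_fset1 bigcap_set1.
Qed.

Lemma endo_mul_continuous :
  continuous (fun p : endo X * endo X => p.1 * p.2).
Proof.
move=> [f g] W [_ [[D' sD' <-] [I0 DI0 I0fg] sub]].
have [F sF defI0] := sD' _ DI0.
apply: (filterS (P := (fun p => p.1 * p.2) @^-1` I0)).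
  by move=> p I0p; apply: sub; exists I0.
rewrite -defI0 in I0fg *; rewrite preimage_bigcap.
apply: filter_bigI => V VF; have := I0fg V VF.
have [x [y ->]] : pointwise_subbase V by apply/set_mem/sF.
move=> /= gfx; exists ([set h : endo X | h x = f x], [set h : endo X | h (f x) = g (f x)]).
  by split; apply: nbhs_pointwise.
by move=> [h k] /= [-> ->].
Qed.

HB.instance Definition _ :=
  isTopologicalSemigroup.Build (endo X) endo_mul_continuous.

Definition Aut : set (endo X) := [set f | is_iso f].

End Endomorphisms.

Arguments Aut {s} X.

(* Main.v *)
Require Import Defs.
From mathcomp Require Import all_boot finmap.
From mathcomp Require Import all_classical.
From mathcomp Require Import topology_structure product_topology.

(** Free amalgamation with gluing inside [X] yields, by Rasiowa-Sikorski chains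
of finite conditions, a self-embedding [f] of [X] such that homomorphisms on
suitable finite sets [U] glue with homomorphisms on the image of [f] and every
finite configuration over [U] is realised off that image, and an endomorphism [g]
such that every finite homomorphism extending [g] on a finite set is realised
by [g] itself on a copy over that set.  Given an endomorphism [w], a
back-and-forth then builds an automorphism [b] with [w = f * b * g]: forth, the
map prescribed on the image of [f] is glued and absorbed by [g]; back, the new
point is reached from outside the image of [f], where nothing is prescribed.
The back-and-forth may start from any automorphism compatible with [w] on a
suitable finite set, so the same [f] and [g] serve all [w] near a given
endomorphism. *)

Set Implicit Arguments.
Unset Strict Implicit.
Unset Printing Implicit Defensive.

Local Open Scope classical_set_scope.

Lemma finite_set_type T (P : set T) : finite_set P -> finite_set [set: P].
Proof.
by rewrite (eq_finite_set (card_setT P)).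
Qed.

(** * Composition and inversion of embeddings and isomorphisms *)

Section Automorphisms.
Context {s : signature}.

Lemma is_hom_comp (A B C : relStruct s) (f : A -> B) (g : B -> C) :
  is_hom f -> is_hom g -> is_hom (g \o f).
Proof. by move=> fh gh r t rt; apply: (gh r (f \o t)); apply: fh. Qed.

Lemma is_embedding_comp (A B C : relStruct s) (f : A -> B) (g : B -> C) :
  is_embedding f -> is_embedding g -> is_embedding (g \o f).
Proof.
move=> [finj fe] [ginj ge]; split; first exact: inj_comp.
by move=> r t; rewrite (fe r t) (ge r (f \o t)).
Qed.

Lemma is_iso_comp (A B C : relStruct s) (f : A -> B) (g : B -> C) :
  is_iso f -> is_iso g -> is_iso (g \o f).
Proof.
by move=> [fe fb] [ge gb]; split; [exact: is_embedding_comp | exact: bij_comp].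
Qed.

Lemma is_iso_id (A : relStruct s) : is_iso (@id A).
Proof. by split; [split | exists id]. Qed.

Lemma is_iso_hom (A B : relStruct s) (f : A -> B) : is_iso f -> is_hom f.
Proof. by move=> [[_ fe] _] r t; rewrite fe. Qed.

Lemma is_iso_inv (A B : relStruct s) (f : A -> B) :
  is_iso f -> exists g, [/\ is_iso g, cancel f g & cancel g f].
Proof.
move=> [[finj fe] [g fK gK]]; exists g; split=> //; split; last by exists f.
split; first exact: can_inj gK.
move=> r t; rewrite (fe r (g \o t)).
by have -> : f \o (g \o t) = t by apply/funext => i /=; rewrite gK.
Qed.

End Automorphisms.

(** * Finite partial maps and free amalgamation inside [X] *)

Section HomogeneousStructure.
Context {s : signature} {X : relStruct s}.
Implicit Types (P Q A B C U : set X) (h k : X -> X).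

(** Partial homomorphisms are encoded as total maps with junk values off [P], so that restricting
    and uniting domains are plain set operations. *)
Definition hom_on h P := forall (r : s) (t : 'I_(arity r) -> X),
  (forall i, P (t i)) -> interp t -> interp (h \o t).

Lemma hom_on_sub h P Q : P `<=` Q -> hom_on h Q -> hom_on h P.
Proof. by move=> PQ hQ r t tP; apply: hQ => i; apply: PQ. Qed.

Lemma eq_hom_on h k P : (forall x, P x -> h x = k x) ->
  hom_on h P -> hom_on k P.
Proof.
move=> hk hP r t tP rt.
suff <- : h \o t = k \o t by exact: hP.
by apply/funext => i /=; exact: hk.
Qed.

Lemma is_hom_on h P : is_hom h -> hom_on h P.
Proof. by move=> hh r t _; apply: hh. Qed.

Lemma induced_age P : finite_set P -> age X (induced P).
Proof.
move=> finP; split; first exact: finite_set_type.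
by exists set_val; split=> //; exact: val_inj.
Qed.

Lemma hom_on_extend h P : hom_homogeneous X -> finite_set P -> hom_on h P ->
  exists2 k, is_hom k & forall x, P x -> k x = h x.
Proof.
move=> homX finP hP.
pose f (x : induced P) : induced (h @` P) :=
  SigSub (mem_set (imageP h (set_valP x))).
have [//||r t rt|k hk kf] := homX P (h @` P) f; first exact: finite_image.
  by apply: (hP r (fun i => set_val (t i))) => // i; exact: set_valP.
by exists k => // x Px; exact: (kf (SigSub (mem_set Px))).
Qed.

Lemma embedding_extend P (e : induced P -> X) : homogeneous X ->
  finite_set P -> is_embedding e ->
  exists2 a : X -> X, is_iso a & forall x : induced P, a (set_val x) = e x.
Proof.
move=> homX finP [einj ee].
pose f (x : induced P) : induced (range e) :=
  SigSub (mem_set (imageP e (I : [set: induced P] x))).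
apply: (homX P (range e) f) => //.
  exact/finite_image/finite_set_type.
split; first by split=> // x y /(congr1 set_val)/einj.
have finj : injective f by move=> x y /(congr1 set_val)/einj.
have /choice[g gP] : forall y : induced (range e), exists x, f x = y.
  by move=> y; have [x _ xy] := set_valP y; exists x; apply: val_inj.
by exists g => // x; apply: finj; rewrite gP.
Qed.

(** Amalgamate [C] and [B] over [A] and realise the amalgam in [X] with [C] fixed pointwise; [b]
    carries [B] to its copy there. All [U] between [A] and [C] are covered, since the gluing
    condition admits partial maps on the amalgam. *)
Lemma free_copy A B C : homogeneous X -> strong_amalgamation_hom_gluing (age X) ->
  finite_set B -> finite_set C -> A `<=` B -> A `<=` C ->
  exists b : X -> X, [/\ is_iso b, forall x, A x -> b x = x,
    forall x, B x -> C (b x) -> A x &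
    forall U h, A `<=` U -> U `<=` C -> hom_on h U -> hom_on h (b @` B) ->
      hom_on h (U `|` b @` B)].
Proof.
move=> homX samX finB finC AB AC.
have finA : finite_set A by exact: sub_finite_set AC finC.
pose e1 (x : induced A) : induced C := SigSub (mem_set (AC _ (set_valP x))).
pose e2 (x : induced A) : induced B := SigSub (mem_set (AB _ (set_valP x))).
have e1e : is_embedding e1.
  by split=> // x y xy; apply: val_inj; exact: (congr1 set_val xy).
have e2e : is_embedding e2.
  by split=> // x y xy; apply: val_inj; exact: (congr1 set_val xy).
have [D [f1 [f2 [[finD [e0 e0e]] f1e f2e [f12 f12I] glue]]]] :=
  samX _ _ _ _ _ (induced_age finA) (induced_age finC) (induced_age finB) e1e e2e.
(* Homogeneity extends the embedding of [C] through the amalgam to [a0]; undoing it by [c] makes [e]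
   restrict to the inclusion on [C]. *)
have [a0 a0i a0E] := embedding_extend homX finC (is_embedding_comp f1e e0e).
have [c [ci a0K cK]] := is_iso_inv a0i.
pose e := c \o e0; have ee : is_embedding e by exact: is_embedding_comp ci.1.
have ef1 (x : induced C) : e (f1 x) = set_val x.
  by rewrite /e /=; have := a0E x => /= <-; rewrite a0K.
have [b bi bE] := embedding_extend homX finB (is_embedding_comp f2e ee).
have bB x (Bx : B x) : b x = e (f2 (SigSub (mem_set Bx))) := bE (SigSub (mem_set Bx)).
have eC x (Cx : C x) : e (f1 (SigSub (mem_set Cx))) = x by rewrite ef1.
have bA x : A x -> b x = x.
  move=> Ax; rewrite (bE (e2 (SigSub (mem_set Ax)))) /=.
  by rewrite -[f2 _](congr1 (fun f => f (SigSub (mem_set Ax))) f12) /= ef1.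
have bC x : B x -> C (b x) -> A x.
  move=> Bx Cbx; have /ee.1 f21 : e (f2 (SigSub (mem_set Bx))) = e (f1 (SigSub (mem_set Cbx))).
    by rewrite eC -bB.
  have : range (f1 \o e1) (f2 (SigSub (mem_set Bx))).
    by rewrite -f12I; split; [rewrite f21; exists (SigSub (mem_set Cbx)) |
      exists (SigSub (mem_set Bx))].
  rewrite f12 => -[y _ /f2e.1 yx].
  have <- : set_val y = x := congr1 set_val yx.
  exact: set_valP.
exists b; split=> // U h AU UC hU hB.
pose V := U `|` b @` B.
have finV : finite_set (h @` V).
  apply: finite_image; rewrite finite_setU; split; last exact: finite_image.
  exact: sub_finite_set UC finC.
(* This is [h] read through [e]. The target is cut down to the finite image of [V], since gluing
   asks for a target in the age. *)
pose g : partial_map D (induced (h @` V)) :=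
  @PartialMap s D (induced (h @` V)) (e @^-1` V)
  (fun d => SigSub (mem_set (imageP h (set_valP d)))).
have Vx x : V x -> exists d, e d = x.
  case=> [/UC Cx|[y By <-]]; first by exists (f1 (SigSub (mem_set Cx))); rewrite eC.
  by exists (f2 (SigSub (mem_set By))); rewrite -bB.
have gh : is_partial_hom g.
  apply: (glue _ g (induced_age finV)).
  - by move=> _ [x _ <-]; left; rewrite /preimage /= ef1; exact: AU (set_valP x).
  - move=> r t rt.
    have rt' : interp (fun i => e (f1 (set_val (t i)))).
      by apply/(ee.2 r (fun i => f1 (set_val (t i))));
         apply/(f1e.2 r (fun i => set_val (t i))).
    apply: (hU r (fun i => e (f1 (set_val (t i))))) rt' => i.
    (* A point of [C] that lies in the copy of [B] belongs to [A], hence to [U]. *)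
    have Cx : C (e (f1 (set_val (t i)))) by rewrite ef1; exact: set_valP.
    have : V (e (f1 (set_val (t i)))) := set_valP (t i).
    case=> // -[x Bx xE]; move: Cx; rewrite -xE => Cbx.
    have Ax : A x by apply: bC.
    by rewrite bA//; exact: AU.
  - move=> r t rt.
    have rt' : interp (fun i => e (f2 (set_val (t i)))).
      by apply/(ee.2 r (fun i => f2 (set_val (t i))));
         apply/(f2e.2 r (fun i => set_val (t i))).
    apply: (hB r (fun i => e (f2 (set_val (t i))))) rt' => i.
    by exists (set_val (set_val (t i))); [exact: set_valP | rewrite bE].
move=> r t tV rt.
have /choice[u uP] : forall i, exists d, e d = t i.
  by move=> i; apply: Vx; exact: tV.
have uV i : (e @^-1` V) (u i) by rewrite /preimage /= uP; exact: tV.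
have tE : (fun i => e (u i)) = t by apply/funext.
have := gh r (fun i => SigSub (mem_set (uV i))).
rewrite /= /comp /= -tE => gr; apply: gr.
by rewrite -tE in rt; apply/(ee.2 r u).
Qed.

End HomogeneousStructure.

(** * Rasiowa-Sikorski chains and their limits *)

Section Chains.

(** Transitivity is asked only through an admissible middle term, as [cond_le] provides it. Requests
    are met arbitrarily late, so one can wait until its precondition has become true. *)
Lemma generic_chain (P : Type) (ok : P -> Prop) (le : P -> P -> Prop)
    (I : countType) (D : I -> P -> Prop) :
  (forall p, le p p) -> (forall p q r, ok q -> le p q -> le q r -> le p r) ->
  (forall i p, ok p -> exists q, [/\ ok q, le p q & D i q]) ->
  forall p, ok p -> exists c : nat -> P,
    [/\ c 0 = p, forall n, ok (c n), forall m n, m <= n -> le (c m) (c n) &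
        forall i n, exists2 m, n <= m & D i (c m)].
Proof.
move=> lexx letr dense p0 ok0.
(* Stage [n] serves request number [logn 2 n], so that each request recurs. *)
have /choice[F FP] : forall np : nat * P, exists q, ok np.2 ->
    [/\ ok q, le np.2 q & forall i, choice.unpickle (logn 2 np.1) = Some i -> D i q].
  move=> [n p]; have [okp|] := pselect (ok p); last by exists p.
  rewrite /=; case: (choice.unpickle _) => [i|]; last by exists p.
  have [q [okq pq Dq]] := dense i p okp.
  by exists q => _; split=> // j [<-].
pose c := fix c n := if n is m.+1 then F (m, c m) else p0.
have okc n : ok (c n) by elim: n => //= n okn; have [] := FP (n, c n) okn.
have lec m n : m <= n -> le (c m) (c n).
  move=> /subnK <-; elim: (n - m) => //= k mk; apply: letr (okc _) mk _.
  by have [] := FP (k + m, c (k + m)) (okc _).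
exists c; split=> // i n.
(* The factor [3 ^ n] pushes the stage past [n] without changing the exponent of 2. *)
have m_ge : n <= 2 ^ choice.pickle i * 3 ^ n.
  by rewrite (leq_trans (ltnW (ltn_expl n (isT : 1 < 3))))// leq_pmull// expn_gt0.
pose m := 2 ^ choice.pickle i * 3 ^ n; exists m.+1; first exact: leqW.
have [_ _] := FP (m, c m) (okc m); apply => /=.
by rewrite lognM ?expn_gt0// pfactorK// lognX muln0 addn0 choice.pickleK.
Qed.

Section Limit.
Context {T : Type} (A : nat -> set T).
Hypothesis coverA : forall x, exists n, A n x.
Hypothesis monoA : forall m n, m <= n -> A m `<=` A n.

Lemma chain_limit U (a : nat -> T -> U) :
  (forall m n x, m <= n -> A m x -> a n x = a m x) ->
  exists f, forall n x, A n x -> f x = a n x.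
Proof.
move=> aA; have /choice[N NP] := coverA.
exists (fun x => a (N x) x) => n x Anx.
by have [Nn|/ltnW nN] := leqP (N x) n; [rewrite -(aA _ n)|rewrite (aA n)].
Qed.

(** Arities are finite, so in a limit each relation can be checked at a single stage. *)
Lemma chain_tuple k (t : 'I_k -> T) : exists n, forall i, A n (t i).
Proof.
have /choice[N NP] := fun i => coverA (t i).
exists (\max_i N i) => i; exact: monoA (leq_bigmax i) _ (NP i).
Qed.

End Limit.

Section LimitMorphisms.
Context {s : signature} {X : relStruct s} (A : nat -> set X).
Hypothesis coverA : forall x, exists n, A n x.
Hypothesis monoA : forall m n, m <= n -> A m `<=` A n.
Variables (f : X -> X) (a : nat -> X -> X).
Hypothesis fA : forall n x, A n x -> f x = a n x.

Lemma limit_tuple k (t : 'I_k -> X) : exists n, f \o t = a n \o t.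
Proof.
have [n tn] := chain_tuple coverA monoA t.
by exists n; apply/funext => i /=; exact: fA.
Qed.

Lemma limit_hom : (forall n, is_hom (a n)) -> is_hom f.
Proof. by move=> ah r t rt; have [n ->] := limit_tuple t; exact: ah. Qed.

Lemma limit_embedding : (forall n, is_embedding (a n)) -> is_embedding f.
Proof.
move=> ae; split=> [x y|r t].
  have [m Amx] := coverA x; have [n Any] := coverA y.
  have mx := monoA (leq_maxl m n) Amx; have nx := monoA (leq_maxr m n) Any.
  by rewrite (fA mx) (fA nx); exact: (ae _).1.
by have [n ->] := limit_tuple t; exact: (ae n).2.
Qed.

End LimitMorphisms.
End Chains.

(** * The generic self-embedding, from finite conditions *)

Section Generic.
Context {s : signature} {X : relStruct s}.
Variable v : X -> nat.
Hypothesis v_inj : injective v.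
Hypothesis homX : homogeneous X.
Hypothesis samX : strong_amalgamation_hom_gluing (age X).
Implicit Types (B U V Y : set X) (h k : X -> X).

(** Finite sets are presented by lists of codes, so that requests form a countable type. *)
Definition coded (L : seq nat) : set X := [set x | v x \in L].

Lemma finite_coded L : finite_set (coded L).
Proof.
apply: (@finite_preimage _ _ [set` L]) => [x y _ _ /v_inj//|].
exact: finite_seq.
Qed.

Lemma codedP B : finite_set B -> exists L, B = coded L.
Proof.
move=> /(finite_image v)/finite_seqP[L BL]; exists L.
apply/seteqP; split=> x.
  by move=> Bx; have : [set` L] (v x) by rewrite -BL; exists x.
rewrite /coded /= => vx; have : [set` L] (v x) by [].
by rewrite -BL => -[y By /v_inj <-].
Qed.

Definition gluable (R U : set X) := forall h,
  hom_on h U -> hom_on h R -> hom_on h (U `|` R).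

(* The finite partial embedding is [cmap] restricted to [cdom]; the rest of
   [cext], beyond its image, is promised to stay outside the final image. *)
Record cond := Cond { cdom : set X; cmap : X -> X; cext : set X }.

Definition cim p := cmap p @` cdom p.

Definition cond_ok p := [/\ finite_set (cdom p), finite_set (cext p),
  is_iso (cmap p) & cim p `<=` cext p].

(** The last two clauses are what [free_copy] yields with [cim p] as common part and [cext p] as the
    set to be avoided. *)
Definition cond_le p q := [/\ cdom p `<=` cdom q,
  forall x, cdom p x -> cmap q x = cmap p x, cext p `<=` cext q,
  forall x, cim q x -> cext p x -> cim p x &
  forall U h, cim p `<=` U -> U `<=` cext p ->
    hom_on h U -> hom_on h (cim q) -> hom_on h (U `|` cim q)].

Lemma cond_le_cim p q : cond_le p q -> cim p `<=` cim q.
Proof.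
by move=> [pq pqE _ _ _] _ [x px <-]; exists x; [exact: pq | exact: pqE].
Qed.

Lemma cond_lexx p : cond_le p p.
Proof.
split=> // U h pU _ hU _; apply: hom_on_sub hU.
by rewrite subUset; split.
Qed.

Lemma cond_le_trans p q r : cond_ok q -> cond_le p q -> cond_le q r -> cond_le p r.
Proof.
move=> [_ _ _ cimq] pq qr; have cqr := cond_le_cim qr.
case: pq qr => [dpq mpq epq ipq gpq] [dqr mqr eqr iqr gqr].
split.
- exact: subset_trans dqr.
- by move=> x px; rewrite mqr ?mpq//; exact: dpq.
- exact: subset_trans eqr.
- by move=> x rx px; apply: ipq => //; apply: iqr => //; exact: epq.
move=> U h pU Up hU hr.
have hUq : hom_on h (U `|` cim q) by apply: gpq => //; exact: hom_on_sub hr.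
apply: hom_on_sub (gqr (U `|` cim q) h _ _ hUq hr).
- by move=> x [Ux|rx]; [left; left | right].
- by move=> x; right.
- by move=> x [/Up/epq//|/cimq].
Qed.

(** Glue with the old image first; the union contains that image, so the last clause of [cond_le]
    applies. Gluability thus persists along a chain. *)
Lemma cond_le_gluable p q U : cond_le p q -> U `<=` cext p -> cim p `<=` cext p ->
  gluable (cim p) U -> gluable (cim q) U.
Proof.
move=> pq Up pp gU h hU hq; have cpq := cond_le_cim pq.
have hUp : hom_on h (U `|` cim p) by apply: gU => //; exact: hom_on_sub hq.
case: pq => _ _ _ _ /(_ (U `|` cim p) h) gpq.
apply: hom_on_sub (gpq _ _ hUp hq).
- by move=> x [Ux|qx]; [left; left | right].
- by move=> x; right.
- by rewrite subUset.
Qed.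

Definition cond_extension p U Y := exists b : X -> X,
  [/\ is_iso b, forall x, U x -> b x = x,
      forall y, Y y -> cim p (b y) -> U (b y), b @` Y `<=` cext p &
      gluable (cim p) (U `|` b @` Y)].

(** The extension is demanded only for sets already gluable; by persistence, a set gluable at some
    stage is served when its request recurs. *)
Definition cond_goal (LM : seq nat * seq nat) p :=
  [/\ coded LM.1 `<=` cext p, coded LM.2 `<=` cdom p &
      gluable (cim p) (coded LM.1) -> cond_extension p (coded LM.1) (coded LM.2)].

(** The automorphism [cmap p] already has values on [Y]; a free copy over the old image moves the
    new ones out of the promised region. *)
Lemma cond_grow_dom p Y V : cond_ok p -> finite_set Y -> finite_set V ->
  exists q, [/\ cond_ok q, cond_le p q, Y `<=` cdom q & V `<=` cext q].
Proof.
case: p => A a E [/= finA finE ai aE] finY finV; rewrite /cim /= in aE.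
pose B := a @` (A `|` Y).
have finB : finite_set B by apply: finite_image; rewrite finite_setU.
have AB : a @` A `<=` B by apply: image_subset; exact: subsetUl.
have [b [bi ba bE bglue]] := free_copy homX samX finB finE AB aE.
have cimE : (b \o a) @` (A `|` Y) = b @` B by rewrite image_comp.
exists (Cond (A `|` Y) (b \o a) (E `|` b @` B `|` V)); split.
- split=> /=; rewrite ?finite_setU//.
  + by split=> //; split=> //; exact: finite_image.
  + exact: is_iso_comp.
  + by rewrite [cim _]cimE => x; left; right.
- split=> /=.
  + exact: subsetUl.
  + by move=> x Ax; rewrite ba//; exists x.
  + by move=> x; left; left.
  + by move=> x; rewrite [cim (Cond (A `|` Y) _ _)]cimE => -[y By <-] Ey; rewrite ba; exact: bE.
  + by move=> U h; rewrite [cim (Cond (A `|` Y) _ _)]cimE; exact: bglue.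
- exact: subsetUr.
- exact: subsetUr.
Qed.

Lemma cond_grow_ext A a E E' : E `<=` E' -> cond_le (Cond A a E) (Cond A a E').
Proof.
move=> EE'; split=> // U h pU _ hU _; apply: hom_on_sub hU.
by rewrite subUset; split.
Qed.

Lemma cond_dense LM p : cond_ok p -> exists q,
  [/\ cond_ok q, cond_le p q & cond_goal LM q].
Proof.
case: LM => L M okp.
have [[A a E] [okq pq Mq Lq]] := cond_grow_dom okp (finite_coded M) (finite_coded L).
have [gL|ngL] := pselect (gluable (a @` A) (coded L)); last first.
  by exists (Cond A a E); split.
case: (okq) => /= finA finE ai aE; rewrite /cim /= in aE.
(* Copy [coded M] over [coded L] off [E]; the copy then joins the promised region, which later
   images avoid. *)
have [] := @free_copy _ X (coded L) (coded L `|` coded M) E homX samX _ finE _ Lq.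
- by rewrite finite_setU; split; exact: finite_coded.
- exact: subsetUl.
move=> b [bi bL bE bglue].
pose E' := E `|` b @` coded M.
have EE' : E `<=` E' by exact: subsetUl.
have qq' : cond_le (Cond A a E) (Cond A a E') by exact: cond_grow_ext.
exists (Cond A a E'); split.
- split=> //=; last exact: subset_trans EE'.
  by rewrite finite_setU; split=> //; exact/finite_image/finite_coded.
- exact: cond_le_trans qq'.
split=> //=; first exact: subset_trans EE'.
move=> _; exists b; split=> //.
- move=> y My /aE Eby.
  have Ly : coded L y by apply: bE => //; right.
  by rewrite bL.
- exact: subsetUr.
move=> h hU hA.
(* Gluing happens twice: [coded L] with the image, then their union, a subset of [E], with the free
   copy. *)
have hLA : hom_on h (coded L `|` a @` A).
  by apply: gL => //; apply: hom_on_sub hU; exact: subsetUl.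
have LM : b @` (coded L `|` coded M) = coded L `|` b @` coded M.
  rewrite image_setU; congr (_ `|` _); apply/seteqP; split=> x.
    by move=> [y Ly <-]; rewrite bL.
  by move=> Lx; exists x => //; exact: bL.
have := bglue (coded L `|` a @` A) h; rewrite LM => /(_ _ _ hLA hU) hh.
apply: hom_on_sub (hh _ _).
- by move=> x [[Lx|bx]|Ax]; [left; left | right; right | left; right].
- exact: subsetUl.
- by rewrite subUset.
Qed.

(** The family [G] abstracts the sets promised and gluable at some stage, so that the back-and-forth
    need not mention conditions. *)
Definition free_embedding (f : X -> X) (G : set X -> Prop) :=
  [/\ is_embedding f, G set0,
      forall U, G U -> finite_set U /\ gluable (range f) U,
      forall V, finite_set V -> exists2 U, V `<=` U & G U &
      forall U Y, G U -> finite_set Y -> exists b : X -> X,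
        [/\ is_iso b, forall x, U x -> b x = x,
            forall y, Y y -> range f (b y) -> U (b y) & G (U `|` b @` Y)]].

Lemma exists_free_embedding : exists f G, free_embedding f G.
Proof.
pose p0 := Cond set0 id set0.
have ok0 : cond_ok p0.
  split=> //=; first exact: is_iso_id.
  by rewrite /cim /= image_set0.
have [c [_ okc lec cD]] :=
  generic_chain cond_lexx cond_le_trans cond_dense ok0.
have domS m n : m <= n -> cdom (c m) `<=` cdom (c n).
  by move=> /lec; case.
have cover x : exists n, cdom (c n) x.
  have [L BL] := codedP (finite_set1 x).
  have [m _ [_ Lm _]] := cD ([::], L) 0.
  by exists m; apply: Lm; rewrite /= -BL.
have [m n x mn|f fc] := chain_limit cover (a := cmap \o c).
  by case: (lec _ _ mn) => _ + _ _ _; exact.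
have cim_range n : cim (c n) `<=` range f.
  by move=> _ [x cx <-]; exists x => //; exact: fc.
have range_cim n y : range f y -> cext (c n) y -> cim (c n) y.
  move=> [x _ <-] nfx; have [m mx] := cover x.
  have le1 := lec _ _ (leq_maxl m n); have le2 := lec _ _ (leq_maxr m n).
  case: le2 => _ _ _ + _; apply => //.
  exists x; first exact: domS (leq_maxl m n) _ mx.
  by rewrite (fc _ _ (domS _ _ (leq_maxl m n) _ mx)).
pose G U := exists2 n, U `<=` cext (c n) & gluable (cim (c n)) U.
have Gup n m U : n <= m -> U `<=` cext (c n) -> gluable (cim (c n)) U ->
    gluable (cim (c m)) U.
  by move=> nm Un; apply: cond_le_gluable (lec _ _ nm) Un _; case: (okc n).
exists f, G; split.
- by apply: (limit_embedding cover domS fc) => n; case: (okc n) => _ _ [].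
- by exists 0 => // h _; rewrite set0U.
- move=> U [n Un Ug]; split.
    by apply: sub_finite_set Un _; case: (okc n).
  move=> h hU hf r t tP rt.
  have /choice[K KP] : forall i, exists m, (U `|` cim (c m)) (t i).
    move=> i; case: (tP i) => [Uti|[x _ <-]]; first by exists 0; left.
    by have [m mx] := cover x; exists m; right; exists x => //; rewrite (fc m).
  pose l := maxn n (\max_i K i).
  have gl : gluable (cim (c l)) U by apply: Gup Ug => //; exact: leq_maxl.
  apply: (gl h) rt => // [|i].
    by apply: hom_on_sub hf; exact: cim_range.
  case: (KP i) => [Uti|Kti]; [left | right] => //.
  apply: (cond_le_cim (lec _ _ _)) Kti.
  exact: leq_trans (leq_bigmax i) (leq_maxr _ _).
- move=> V finV; have [L VL] := codedP finV.
  have [n _ [/= Ln _ _]] := cD (L, [::]) 0.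
  (* The promised set contains the image of its own stage, so gluing there is trivial. *)
  exists (cext (c n)); first by rewrite VL.
  exists n => // h hE _; apply: hom_on_sub hE.
  by rewrite subUset; split=> //; case: (okc n).
move=> U Y [n Un Ug] finY.
have finU : finite_set U by apply: sub_finite_set Un _; case: (okc n).
have [L UL] := codedP finU; have [M YM] := codedP finY.
(* The request is taken past stage [n], where [U] is still gluable. *)
have [m nm [/=]] := cD (L, M) n; rewrite -UL -YM => Um _.
case; first exact: Gup Ug.
move=> b [bi bU bY bYm bg]; exists b; split=> //.
- by move=> y Yy fby; apply: bY => //; apply: range_cim => //; apply: bYm; exists y.
- by exists m => //; rewrite subUset.
Qed.

(** * The absorbing endomorphism *)

Definition map_le (p q : set X * (X -> X)) :=
  p.1 `<=` q.1 /\ forall x, p.1 x -> q.2 x = p.2 x.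

Lemma map_lexx p : map_le p p. Proof. by split. Qed.

Lemma map_le_trans p q r : map_le p q -> map_le q r -> map_le p r.
Proof.
move=> [pq qE] [qr rE]; split; first exact: subset_trans qr.
by move=> x px; rewrite rE ?qE//; exact: pq.
Qed.

(** Taking [k] total loses nothing: finite partial homomorphisms extend by
    homomorphism-homogeneity. *)
Definition absorbing_endo (g : X -> X) := is_hom g /\
  forall B Y k, finite_set B -> finite_set Y -> is_hom k ->
    (forall x, B x -> k x = g x) ->
    exists b : X -> X, [/\ is_iso b, forall x, B x -> b x = x &
      forall y, Y y -> g (b y) = k y].

Hypothesis hhX : hom_homogeneous X.

(** After a free copy over [B], the map [h] on [C] and [k] transported to the copy agree where they
    meet; they glue, and the result extends by homomorphism-homogeneity. *)
Lemma absorb_step B C Y h k : finite_set B -> finite_set C -> finite_set Y ->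
  is_hom h -> is_hom k -> B `<=` C -> (forall x, B x -> k x = h x) ->
  exists b h' : X -> X, [/\ is_iso b, is_hom h', forall x, B x -> b x = x,
    forall x, C x -> h' x = h x & forall y, Y y -> h' (b y) = k y].
Proof.
move=> finB finC finY hh kh BC kB.
have finBY : finite_set (B `|` Y) by rewrite finite_setU.
have BBY : B `<=` B `|` Y by exact: subsetUl.
have [b [bi bB bC bglue]] := free_copy homX samX finBY finC BBY BC.
have [b' [b'i bK b'K]] := is_iso_inv bi.
pose hk x := if x \in C then h x else k (b' x).
have hkC x : C x -> hk x = h x by rewrite /hk => /mem_set ->.
have hkb y : (B `|` Y) y -> hk (b y) = k y.
  move=> By; rewrite /hk; case: ifPn => [/set_mem Cby|_]; last by rewrite bK.
  by have By' := bC _ By Cby; rewrite bB// kB.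
have hom_hk : hom_on hk (C `|` b @` (B `|` Y)).
  apply: bglue => //.
    by apply: (eq_hom_on (h := h)) => [x /hkC|]; last exact: is_hom_on.
  apply: (eq_hom_on (h := k \o b')).
    by move=> _ [y By <-]; rewrite hkb//= bK.
  by apply/is_hom_on/(is_hom_comp _ kh)/is_iso_hom.
have [|h' h'h h'E] := hom_on_extend hhX _ hom_hk.
  by rewrite finite_setU; split=> //; exact: finite_image.
exists b, h'; split=> // [x Cx|y Yy]; first by rewrite h'E ?hkC//; left.
by rewrite h'E ?hkb//; right=> //; exists y => //; right.
Qed.

Lemma exists_absorbing_endo : exists g, absorbing_endo g.
Proof.
pose ok (p : set X * (X -> X)) := finite_set p.1 /\ is_hom p.2.
(* The second list codes the graph of [k] on [Y], which reduces all [k] to countably many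
   requests. *)
pose goal (LM : seq nat * seq (nat * nat)) (p : set X * (X -> X)) :=
  coded LM.1 `<=` p.1 /\
  forall k, is_hom k -> (forall x, coded LM.1 x -> k x = p.2 x) ->
    (forall y z, (v y, v z) \in LM.2 -> k y = z) ->
    exists b : X -> X, [/\ is_iso b, forall x, coded LM.1 x -> b x = x &
      forall y z, (v y, v z) \in LM.2 -> p.1 (b y) /\ p.2 (b y) = z].
have dense LM p : ok p -> exists q, [/\ ok q, map_le p q & goal LM q].
  case: LM p => L M [C h] [/= finC hh].
  pose C' := C `|` coded L.
  have finC' : finite_set C' by rewrite finite_setU; split=> //; exact: finite_coded.
  have LC' : coded L `<=` C' by exact: subsetUr.
  pose Y := coded (map fst M).
  have MY y z : (v y, v z) \in M -> Y y by move=> yz; exact: (map_f fst yz).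
  have [[k [kh kL kM]]|nk] := pselect (exists k, [/\ is_hom k,
      forall x, coded L x -> k x = h x & forall y z, (v y, v z) \in M -> k y = z]);
    last first.
    exists (C', h); split=> //; first by split=> //; exact: subsetUl.
    by split=> //= k kh kL kM; case: nk; exists k.
  have [b [h' [bi h'h bL h'C h'b]]] :=
    absorb_step (finite_coded L) finC' (finite_coded _ : finite_set Y) hh kh LC' kL.
  exists (C' `|` b @` Y, h'); split.
  - split=> //=; rewrite finite_setU; split=> //.
    exact/finite_image/finite_coded.
  - split=> /= x; first by left; left.
    by move=> Cx; apply: h'C; left.
  (* Every [k1] meeting the request takes the values listed in [M], so the copy made for [k] serves
     it too. *)
  split=> /= [x Lx|k1 _ _ _]; first by left; right.
  exists b; split=> // y z yz; split; last by rewrite h'b ?(kM _ _ yz)//; exact: MY yz.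
  by right; exists y => //; exact: MY yz.
have ok0 : ok (set0, id) by split.
have [c [_ okc lec cD]] := generic_chain map_lexx
  (fun p q r _ => @map_le_trans p q r) dense ok0.
have domS m n : m <= n -> (c m).1 `<=` (c n).1 by case/lec.
have cover x : exists n, (c n).1 x.
  have [L BL] := codedP (finite_set1 x).
  have [m _ [Lm _]] := cD (L, [::]) 0.
  by exists m; apply: Lm; rewrite /= -BL.
have [m n x mn|g gc] := chain_limit cover (a := snd \o c).
  by case: (lec _ _ mn) => _; exact.
exists g; split; first by apply: (limit_hom cover domS gc) => n; case: (okc n).
move=> B Y k finB finY kh kB.
have [L BL] := codedP finB.
have /finite_seqP[M YM] := finite_image (fun y => (v y, v (k y))) finY.
have MP y z : (v y, v z) \in M -> Y y /\ k y = z.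
  move=> yz; have : [set` M] (v y, v z) by [].
  by rewrite -YM => -[x Yx [/v_inj <- /v_inj]].
have [m _ [/= Lm]] := cD (L, M) 0; rewrite -BL in Lm * => /(_ k kh).
case=> [x Bx|y z /MP[]//|b [bi bB bM]].
  by rewrite kB// (gc m)//; exact: Lm.
exists b; split=> // y Yy.
have [|cby by_] := bM y (k y).
  by have : [set` M] (v y, v (k y)) by rewrite -YM; exists y.
by rewrite (gc m).
Qed.

(** * Back-and-forth for the middle factor *)

Section BackAndForth.
Variables (f g : X -> X) (G : set X -> Prop).
Hypothesis freef : free_embedding f G.
Hypothesis absg : absorbing_endo g.

Lemma back_and_forth (w : X -> X) U b : is_hom w -> G U -> is_iso b ->
  (forall x, U (f x) -> g (b (f x)) = w x) ->
  exists c : X -> X, [/\ is_iso c, forall x, U x -> c x = b x &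
    forall x, g (c (f x)) = w x].
Proof.
case: freef absg => -[finj fe] G0 Gglue Gcof Gext [gh gabs] wh.
pose ok (p : set X * (X -> X)) := [/\ G p.1, is_iso p.2 &
  forall x, p.1 (f x) -> g (p.2 (f x)) = w x].
have /choice[f' f'P] : forall z, exists x, range f z -> f x = z.
  move=> z; have [[x _ xz]|nz] := pselect (range f z); first by exists x.
  by exists z.
have f'K x : f' (f x) = x by apply: finj; rewrite f'P//; exists x.
have forth p V : ok p -> finite_set V ->
    exists q, [/\ ok q, map_le p q & V `<=` q.1].
  case: p => {}U {}b [/= GU bi bw] finV.
  have [finU Uglue] := Gglue _ GU.
  have [U' UU' GU'] : exists2 U', U `|` V `<=` U' & G U'.
    by apply: Gcof; rewrite finite_setU.
  have [finU' _] := Gglue _ GU'.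
  have [b' [b'i bK b'K]] := is_iso_inv bi.
  (* By [bw] the two prescriptions agree where [U] meets the range of [f], so [Uglue] makes [h] a
     homomorphism on the union. *)
  pose h x := if x \in U then g (b x) else w (f' x).
  have hU x : U x -> h x = g (b x) by rewrite /h => /mem_set ->.
  have hf x : h (f x) = w x.
    by rewrite /h; case: ifPn => [/set_mem /bw|]; rewrite ?f'K.
  have hom_h : hom_on h (U `|` range f).
    apply: Uglue.
      apply: (eq_hom_on (h := g \o b)); first by move=> x /hU.
      by apply/is_hom_on/(is_hom_comp _ gh)/is_iso_hom.
    move=> r t tf rt.
    have tE : f \o (f' \o t) = t by apply/funext => i /=; exact: f'P.
    have -> : h \o t = w \o (f' \o t) by rewrite -{1}tE; apply/funext => i /=.
    by apply: wh; apply/(fe r); rewrite tE.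
  pose F := U `|` (U' `&` range f).
  have finF : finite_set F.
    by rewrite finite_setU; split=> //; exact: finite_setIl.
  have [k kh kF] : exists2 k, is_hom k & forall x, F x -> k x = h x.
    apply: hom_on_extend => //; apply: hom_on_sub hom_h.
    by move=> x [Ux|[_ fx]]; [left | right].
  (* Transported by [b'], the map [k] agrees with [g] on the image of [U], so [g] absorbs it over
     that image. *)
  have [d [di dU dY]] : exists d : X -> X, [/\ is_iso d,
      forall x, (b @` U) x -> d x = x &
      forall y, (b @` U') y -> g (d y) = (k \o b') y].
    apply: gabs; [exact: finite_image | exact: finite_image | |].
      by apply/(is_hom_comp _ kh)/is_iso_hom.
    by move=> _ [x Ux <-] /=; rewrite bK kF ?hU//; left.
  exists (U', d \o b); split.
  - split=> //=; first exact: is_iso_comp.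
    move=> x U'fx; rewrite dY /= ?bK; last by exists (f x).
    by rewrite kF ?hf//; right; split=> //; exists x.
  - split=> /= x Ux; first by apply: UU'; left.
    by rewrite dU//; exists x.
  - by move=> x Vx; apply: UU'; right.
have back p V : ok p -> finite_set V ->
    exists q, [/\ ok q, map_le p q & V `<=` q.2 @` q.1].
  case: p => {}U {}b [/= GU bi bw] finV.
  have [b' [b'i bK b'K]] := is_iso_inv bi.
  (* The preimages of [V] under [b] are moved over [U] so that any landing in the range of [f] lie
     in [U]: no new value is prescribed, and [b \o d'] still reaches [V]. *)
  have [d [di dU dY GUd]] := Gext _ _ GU (finite_image b' finV).
  have [d' [d'i dK d'K]] := is_iso_inv di.
  have d'U x : U x -> d' x = x by move=> Ux; rewrite -[in LHS](dU _ Ux) dK.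
  exists (U `|` d @` (b' @` V), b \o d'); split.
  - split=> //=; first exact: is_iso_comp.
    move=> x Ufx.
    suff Ux : U (f x) by rewrite d'U// bw.
    by case: Ufx => // -[y Vy yx]; rewrite -yx; apply: dY => //; rewrite yx; exists x.
  - by split=> /= x Ux; [left | rewrite d'U].
  - move=> x Vx; exists (d (b' x)) => /=; last by rewrite dK b'K.
    by right; exists (b' x) => //; exists x.
pose goal (L : seq nat) (p : set X * (X -> X)) :=
  coded L `<=` p.1 /\ coded L `<=` p.2 @` p.1.
have dense L p : ok p -> exists q, [/\ ok q, map_le p q & goal L q].
  move=> okp; have finL := finite_coded L.
  have [q [okq pq Lq]] := forth p _ okp finL.
  have [r [okr qr Lr]] := back q _ okq finL.
  exists r; split=> //; first exact: map_le_trans qr.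
  by split=> //; apply: subset_trans Lq _; case: qr.
move=> GU bi bw.
have ok0 : ok (U, b) by split.
have [c [c0 okc lec cD]] := generic_chain
  map_lexx (fun p q r _ => @map_le_trans p q r) dense ok0.
have domS m n : m <= n -> (c m).1 `<=` (c n).1 by case/lec.
have hit x : exists n, (c n).1 x /\ ((c n).2 @` (c n).1) x.
  have [L BL] := codedP (finite_set1 x).
  have [m _ [Lm Lm']] := cD L 0; rewrite -BL in Lm Lm'.
  by exists m; split; [exact: Lm | exact: Lm'].
have cover x : exists n, (c n).1 x by have [n []] := hit x; exists n.
have [m n x mn|e ec] := chain_limit cover (a := snd \o c).
  by case: (lec _ _ mn) => _; exact.
have [einj ee] : is_embedding e.
  by apply: (limit_embedding cover domS ec) => n; case: (okc n) => _ [].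
have /choice[e' e'K] : forall y, exists x, e x = y.
  by move=> y; have [n [_ [x nx xy]]] := hit y; exists x; rewrite (ec n).
exists e; split.
- by split; last by exists e' => // x; apply: einj; rewrite e'K.
- by move=> x Ux; rewrite (ec 0) /= c0.
- move=> x; have [n nx] := cover (f x).
  by rewrite (ec n)//=; case: (okc n) => _ _; exact.
Qed.

End BackAndForth.

(** * Neighbourhoods in the pointwise topology and property X *)

Lemma nbhs_endo_finite (x : endo X) (F : set X) : finite_set F ->
  nbhs x [set y : endo X | forall a, F a -> y a = x a].
Proof.
move=> /codedP[L ->]; elim: L => [|n L IHL]; first exact: filterS filterT.
have nn : nbhs x [set y : endo X | forall a, v a = n -> y a = x a].
  have [[a <-]|na] := pselect (exists a, v a = n).
    by apply: filterS (nbhs_pointwise x a) => y ya b /v_inj ->.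
  by apply: filterS filterT => y _ a an; case: na; exists a.
apply: filterS (filterI nn IHL) => y [yn yL] a.
by rewrite /coded /= inE => /orP[/eqP/yn|/yL].
Qed.

End Generic.

(** A subbasic set constrains one argument, so a finite intersection of them constrains finitely
    many. *)
Lemma nbhs_endoP (s : signature) (X : relStruct s) (x : endo X) (B : set (endo X)) :
  nbhs x B -> exists2 F : set X, finite_set F &
    forall y : endo X, (forall a, F a -> y a = x a) -> B y.
Proof.
move=> [_ [[D' sD' <-] [I0 DI0 I0x] sub]].
have [W sW defI0] := sD' _ DI0.
have /choice[F FP] : forall V : set (endo X), exists F : set X, finite_set F /\
    ([set` W] V -> forall y : endo X, (forall a, F a -> y a = x a) -> V y).
  move=> V; have [VW|nVW] := pselect ([set` W] V); last by exists set0.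
  have [a [b Vab]] : pointwise_subbase V by apply/set_mem/sW.
  have : V x by rewrite -defI0 in I0x; exact: I0x.
  rewrite Vab /= => xab; exists [set a]; split=> // _ y /(_ a erefl) /= ->.
  exact: xab.
exists (\bigcup_(V in [set` W]) F V).
  by apply: bigcup_finite => [|V _]; [exact: finite_fset | case: (FP V)].
move=> y yF; apply: sub; exists I0 => //; rewrite -defI0.
change ((\bigcap_(V in [set` W]) V) y) => V VW.
by have [_ /(_ VW)] := FP V; apply=> a Fa; apply: yF; exists V.
Qed.

Theorem theoremB (s : signature) (X : relStruct s) :
  countable [set: X]%classic ->
  omega_categorical X ->
  homogeneous X ->
  hom_homogeneous X ->
  strong_amalgamation_hom_gluing (age X) ->
  property_X (Aut X).
Proof.
move=> /countable_injP[v vinj] _ homX hhX samX x.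
have v_inj : injective v by move=> a b; apply: vinj; rewrite in_setT.
have [f [G fG]] := exists_free_embedding v_inj homX samX.
have [g gabs] := exists_absorbing_endo v_inj homX samX hhX.
have bf := back_and_forth v_inj hhX fG gabs.
have [fe G0 _ Gcof _] := fG; have [gh _] := gabs.
have fh : is_hom f by move=> r t; rewrite (fe.2 r t).
(* Starting from the empty set and the identity factorises [x] itself. *)
have [t [ti _ tx]] := bf x set0 id (endo_hom x) G0 (is_iso_id X) (fun _ => False_ind _).
exists (Endo fh), (Endo gh), (Endo (is_iso_hom ti)); split=> //.
  by apply: endoP => a; rewrite /= tx.
move=> B /nbhs_endoP[F finF FB].
(* If [y] agrees with [x] on the preimage of [U] under [f], then [t] is a legitimate start over [U]
   for [y]; the resulting automorphism agrees with [t] on [F], hence lies in [B]. *)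
have [U FU GU] := Gcof _ finF.
have finU : finite_set (f @^-1` U).
  apply: finite_preimage; first by move=> a b _ _ /fe.1.
  by case: fG => _ _ /(_ _ GU)[].
apply: filterS (nbhs_endo_finite v_inj x finU) => y yU.
have [|b [bi bU by_]] := bf y U t (endo_hom y) GU ti.
  by move=> a Ufa; rewrite tx yU.
exists (Endo (is_iso_hom bi)); last by apply: endoP => a; rewrite /= by_.
by split=> //; apply: FB => a /FU Ua /=; exact: bU.
Qed.
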